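(* Let $\beta\in[0,1)$, $\gamma=1-\beta$, $k\le n$, and let $f\le\beta k$ be a nonnegative integer. In the synchronous Data Retrieval model with $k$ peers, an $n$-bit source and at most $f$ crash faults, there is a deterministic protocol that solves Download with $$\mathcal Q=O\!\left(\frac{n}{\gamma k}\right),\qquad \mathcal T=O(n+f),\qquad \mathcal M=O\big(k\cdot(n+f)\big).$$
   Context: Data Retrieval (DR) model. There are $k$ peers with unique IDs forming a complete network, and a trusted read-only external source storing an array $X=(b_1,\dots,b_n)\in\{0,1\}^n$, with $n\ge k$. A query $\mathrm{Query}(i)$ by a peer to the source returns $b_i$. Synchronous rounds: each round has three sub-rounds: (1) each peer sends any number (between $0$ and $n$) of queries to the source; (2) the source answers all of them; (3) peers exchange messages, delivered within the round. A peer may send a different message to each other peer. Every message has size $O(\log n)$ bits. Local computation is free and instantaneous. Crash faults: a crashed peer stops its execution permanently at an arbitrary time chosen by an all-knowing adversary, possibly in the middle of a sub-round (after sending some but not all of its messages). At most $f$ peers crash; the others are nonfaulty. The adversary also chooses $X$. Download problem: every nonfaulty peer must output an array equal to $X$. Complexity measures: $\mathcal Q$ = maximum number of bits queried by any nonfaulty peer; $\mathcal T$ = number of rounds until termination; $\mathcal M$ = total number of messages sent by nonfaulty peers. All are worst-case upper bounds; hidden constants are absolute. *)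

(* Defs.v *)
From mathcomp Require Import all_boot all_order all_algebra.
From mathcomp Require Import reals.

Set Implicit Arguments.
Unset Strict Implicit.
Unset Printing Implicit Defensive.

Import GRing.Theory Num.Theory.

(* A deterministic protocol for k peers, an n-bit source and messages of at
   most b bits. In every round an active peer p in state s
   - sends the queries [queries p s] and updates its state with [learn], the
     answer at i being [None] when i was not queried;
   - then, in the updated state, sends to each other peer q the message
     [send p _ q] ([None] = no message, [Some] of the empty string = a message),
     and updates its state with [receive], which is given the message received
     from each peer.
   A peer terminates as soon as [output] is [Some]. *)
Record protocol (n k b : nat) := Protocol {
  state : Type;
  init : 'I_k -> state;
  queries : 'I_k -> state -> {set 'I_n};
  learn : 'I_k -> state -> ('I_n -> option bool) -> state;
  send : 'I_k -> state -> 'I_k -> option (b.-bseq bool);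
  receive : 'I_k -> state -> ('I_k -> option (b.-bseq bool)) -> state;
  output : 'I_k -> state -> option (n.-tuple bool)
}.

(* [Crash r D]: the peer crashes in round r, and among its messages of round r
   exactly those addressed to D leave it. D = set0 covers crashes in the
   query and answer sub-rounds: which of its queries were sent has no effect on
   the other peers. D = setT covers crashes after the last message. *)
Record crash_event (k : nat) := Crash {
  crash_round : nat;
  crash_delivers : {set 'I_k}
}.

(* The protocol being deterministic, an all-knowing adversary amounts to an
   arbitrary crash schedule fixed together with the input. *)
Definition adversary (k : nat) := 'I_k -> option (crash_event k).

Definition faulty (k : nat) (A : adversary k) : {set 'I_k} :=
  [set p | isSome (A p)].

Section Execution.

Variables (n k b : nat) (P : protocol n k b).
Variables (X : n.-tuple bool) (A : adversary k).

Section Round.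

(* Round r (counted from 0), started with peer p in state [s p]. *)
Variables (r : nat) (s : 'I_k -> state P).

Definition active (p : 'I_k) : bool :=
  ~~ isSome (output p (s p)) &&
  (if A p is Some c then r <= crash_round c else true).

Definition asked (p : 'I_k) : {set 'I_n} :=
  if active p then queries p (s p) else set0.

Definition informed (p : 'I_k) : state P :=
  learn p (s p) (fun i => if i \in asked p then Some (tnth X i) else None).

Definition sent (p q : 'I_k) : option (b.-bseq bool) :=
  if active p && (q != p) then send p (informed p) q else None.

Definition delivered (p q : 'I_k) : option (b.-bseq bool) :=
  if A p is Some c then
    if (r == crash_round c) && (q \notin crash_delivers c) then None
    else sent p q
  else sent p q.

Definition next_state (p : 'I_k) : state P :=
  if active p then receive p (informed p) (fun q => delivered q p) else s p.

End Round.

Fixpoint state_after (t : nat) : 'I_k -> state P :=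
  if t is r.+1 then next_state r (state_after r) else @init n k b P.

Definition output_after (t : nat) (p : 'I_k) : option (n.-tuple bool) :=
  output p (state_after t p).

Definition queries_made (t : nat) (p : 'I_k) : nat :=
  \sum_(r < t) #|asked r (state_after r) p|.

Definition messages_sent (t : nat) (p : 'I_k) : nat :=
  \sum_(r < t) #|[set q | isSome (sent r (state_after r) p q)]|.

End Execution.

Section Complexity.

Variables (R : realType) (n k b : nat) (P : protocol n k b) (f : nat).

Definition solves_download : Prop :=
  forall (X : n.-tuple bool) (A : adversary k), #|faulty A| <= f ->
  forall p, p \notin faulty A -> exists t, output_after P X A t p = Some X.

Definition query_complexity_le (B : R) : Prop :=
  forall (X : n.-tuple bool) (A : adversary k), #|faulty A| <= f ->
  forall p, p \notin faulty A ->
  forall t, ((queries_made P X A t p)%:R <= B)%R.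

Definition time_complexity_le (B : nat) : Prop :=
  forall (X : n.-tuple bool) (A : adversary k), #|faulty A| <= f ->
  forall p, p \notin faulty A -> isSome (output_after P X A B p).

Definition message_complexity_le (B : nat) : Prop :=
  forall (X : n.-tuple bool) (A : adversary k), #|faulty A| <= f ->
  forall t, \sum_(p | p \notin faulty A) messages_sent P X A t p <= B.

End Complexity.

(* Main.v *)
Require Import Defs.
From mathcomp Require Import all_boot all_order all_algebra.
From mathcomp Require Import reals.
From mathcomp Require Import zify.

Set Implicit Arguments.
Unset Strict Implicit.
Unset Printing Implicit Defensive.

Import Order.TTheory GRing.Theory Num.Theory.

(** The peers 0, ..., k-1 chair in turn. The chair reads new bits in increasing
   order of index, one per round, and broadcasts each; after [quota] =
   O(n/(k-f)) bits it falls silent, as it does when it crashes. Only k-f chairs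
   need to survive for all n bits to be read, so one pass over the peers is
   enough and nobody reads more than [quota] bits.

   Each peer knows a prefix of X, and in every round either the prefix grows or
   the clock advances, so that length + clock = r in round r. The clock alone
   decides who chairs: 3q is an idle round before the term of q, at 3q+1 the
   chair q repeats the last bit it knows, and 3q+2 lasts as long as bits arrive
   from q. A crash during a broadcast leaves some peers one bit, hence one clock
   tick, apart from the others; the next living chair closes this gap, and the
   idle round ensures that a peer listens (at 3q+2) exactly when what it hears is
   the bit it misses. Hence clocks never differ by more than 1, the new bits
   broadcast by nonfaulty chairs have distinct indices, and all clocks reach 3k
   within n + 3k <= 4n rounds. *)

(** * The protocol of rotating chairs *)

Record chair_state (n : nat) := ChairState {
  prefix : seq bool;
  clock : nat;
  reads : nat;
  (* the bit read in the current round, not yet in [prefix] *)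
  pending : option bool
}.

Section ChairProtocol.

Variables (n k b quota : nat).

Implicit Types (p q x y : 'I_k) (s : chair_state n).

Definition encode (v : bool) : b.-bseq bool := insub_bseq b [:: v].

Definition decode (m : b.-bseq bool) : bool := head false m.

Lemma encodeK : 0 < b -> cancel encode decode.
Proof.
by move=> b_gt0 v; rewrite /decode /encode /insub_bseq /insubd insubT.
Qed.

Definition next_read p s : option 'I_n :=
  if (clock s == 3 * p + 2) && (reads s < quota) then insub (size (prefix s))
  else None.

Definition announcement p s : option bool :=
  if pending s is Some v then Some v
  else if (clock s == 3 * p + 1) && (0 < size (prefix s))
       then Some (last false (prefix s)) else None.

(** Messages carry no index: the clock names the sender, and the bit heard is appended to the
    prefix. *)
Definition heard_from_chair s (inbox : 'I_k -> option (b.-bseq bool)) :=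
  if clock s %% 3 == 2
  then obind (fun q => omap decode (inbox q)) (insub (clock s %/ 3))
  else None.

Definition chair_receive s inbox : chair_state n :=
  let news := if pending s is Some v then Some v
              else heard_from_chair s inbox in
  if news is Some v
  then ChairState n (rcons (prefix s) v) (clock s)
                  (reads s + isSome (pending s)) None
  else ChairState n (prefix s) (clock s).+1 (reads s) None.

Definition chair_protocol : protocol n k b :=
  {| state := chair_state n;
     init := fun=> ChairState n [::] 0 0 None;
     queries := fun p s => [set i | next_read p s == Some i];
     learn := fun p s answer =>
       ChairState n (prefix s) (clock s) (reads s) (obind answer (next_read p s));
     send := fun p s _ => omap encode (announcement p s);
     receive := fun _ => chair_receive;
     output := fun _ s =>
       if 3 * k <= clock s then Some [tuple nth false (prefix s) i | i < n]
       else None |}.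

(** * One round of an execution, in closed form *)

Section Run.

Variables (X : n.-tuple bool) (A : adversary k).

Local Notation P := chair_protocol.
Local Notation st r x := (state_after P X A r x : chair_state n).

(** A peer still counts as alive in its crash round, when its messages may be lost; [alive r.+1 x]
    guarantees that all messages of [x] in round [r] arrive. *)
Definition alive r x := if A x is Some c then r <= crash_round c else true.

Definition working r x := (clock (st r x) < 3 * k) && alive r x.

Definition fresh r x :=
  [&& working r x, clock (st r x) == 3 * x + 2, reads (st r x) < quota
    & size (prefix (st r x)) < n].

Definition speaks r x :=
  working r x &&
  (fresh r x || (clock (st r x) == 3 * x + 1) && (0 < size (prefix (st r x)))).

Definition utterance r x :=
  if fresh r x then nth false X (size (prefix (st r x)))
  else last false (prefix (st r x)).

Definition mail r x y := delivered X A r (state_after P X A r) x y.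

(** For a working peer, the clock stands still exactly when the prefix grows; see [clockS] and
    [size_prefixS]. *)
Definition stays r x :=
  working r x &&
  (fresh r x ||
   isSome (heard_from_chair (st r x) (fun q => mail r q x))).

Lemma activeE r x : active A r (state_after P X A r) x = working r x.
Proof. by rewrite /active /working /alive /= ltnNge; case: ifP. Qed.

Lemma next_readE r x : working r x ->
  next_read x (st r x) =
  if fresh r x then insub (size (prefix (st r x))) else None.
Proof.
rewrite /fresh /next_read => -> /=.
case: eqP => //= _; case: ltnP => //= _; case: ltnP => //= h.
by rewrite insubN // -leqNgt.
Qed.

Lemma informedE r x : informed X A r (state_after P X A r) x =
  ChairState n (prefix (st r x)) (clock (st r x)) (reads (st r x))
   (if working r x then
      if fresh r x then Some (nth false X (size (prefix (st r x)))) else None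
    else None).
Proof.
rewrite /informed /=; congr ChairState.
rewrite /asked activeE; case: ifP => [w|w].
  rewrite next_readE //=; case: ifP => // fr; case: insubP => [i _ e|] /=.
    by rewrite inE next_readE // fr -e valK eqxx (tnth_nth false).
  by case/and4P: fr => _ _ _ ->.
by case: next_read => //= i; rewrite inE.
Qed.

Lemma card_asked r x :
  #|asked A r (state_after P X A r) x| = fresh r x.
Proof.
rewrite /asked activeE; case: ifP => [w|w]; last by rewrite /fresh w cards0.
rewrite /= next_readE //; case: ifP => fr; last first.
  by apply/eqP; rewrite cards_eq0; apply/eqP/setP=> i; rewrite !inE.
case/and4P: fr => _ _ _ h; rewrite insubT.
by rewrite -[RHS](cards1 (Ordinal h)); apply: eq_card => i; rewrite !inE eq_sym.
Qed.

Lemma sentE r x y : sent X A r (state_after P X A r) x y =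
  if speaks r x && (y != x) then Some (encode (utterance r x)) else None.
Proof.
rewrite /sent activeE /speaks; case w: (working r x) => //.
rewrite informedE w /= /announcement /utterance /=.
case: (fresh r x) => //=; case: (y != x); rewrite ?andbF // andbT.
by case: ifP.
Qed.

Lemma mail_sent r x y v : mail r x y = Some v ->
  [/\ speaks r x, y != x & v = encode (utterance r x)].
Proof.
rewrite /mail /delivered sentE.
have E: (if speaks r x && (y != x) then Some (encode (utterance r x))
         else None) = Some v ->
  [/\ speaks r x, y != x & v = encode (utterance r x)].
  by case: ifP => // /andP[] ? ? [<-].
by case: (A x) => // c; case: ifP.
Qed.

Lemma sent_mail r x y : speaks r x -> y != x -> alive r.+1 x ->
  mail r x y = Some (encode (utterance r x)).
Proof.
rewrite /mail /delivered sentE /alive => -> -> /=.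
by case: (A x) => // c h; rewrite ltn_eqF.
Qed.

Lemma next_stateE r x : st r.+1 x =
  if working r x then
    ChairState n
     (if stays r x then
        rcons (prefix (st r x))
          (if fresh r x then nth false X (size (prefix (st r x)))
           else odflt false
                  (heard_from_chair (st r x) (fun q => mail r q x)))
      else prefix (st r x))
     (clock (st r x) + ~~ stays r x) (reads (st r x) + fresh r x) None
  else st r x.
Proof.
rewrite /= /next_state activeE /stays; case: ifP => // w.
rewrite informedE w /= /chair_receive /=.
case: (fresh r x) => /=; first by rewrite addn0.
rewrite /heard_from_chair /= -/(mail r).
case: ifP => /= _; last by rewrite addn0 addn1.
case: insub => [q|] /=; last by rewrite addn0 addn1.
by rewrite /mail; case: delivered => /= [v|]; rewrite ?addn0 ?addn1.
Qed.

Lemma clockS r x :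
  clock (st r.+1 x) = clock (st r x) + (working r x && ~~ stays r x).
Proof. by rewrite next_stateE; case: ifP => //= _; rewrite addn0. Qed.

Lemma size_prefixS r x :
  size (prefix (st r.+1 x)) = size (prefix (st r x)) + stays r x.
Proof.
rewrite next_stateE; case: ifP => /= w; last by rewrite /stays w addn0.
by case: ifP; rewrite ?size_rcons ?addn0 ?addn1.
Qed.

Lemma readsS r x : reads (st r.+1 x) = reads (st r x) + fresh r x.
Proof.
by rewrite next_stateE; case: ifP => //= w; rewrite /fresh w addn0.
Qed.


Lemma aliveW r x : alive r.+1 x -> alive r x.
Proof. by rewrite /alive; case: (A x) => // c /ltnW. Qed.

Lemma nonfaulty_alive r x : x \notin faulty A -> alive r x.
Proof. by rewrite inE /alive; case: (A x). Qed.

(** One bit must fit in a message once there are two peers. For [n = k = 1] the length bound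
    [up_log 2 n] is 0, and no message is sent. *)
Hypothesis b_gt0 : 1 < k -> 0 < b.

(** Merges the two sources of a new bit, reading and listening: a reading chair counts as hearing
    itself. *)
Lemma stays_chair r x : stays r x ->
  exists q, [/\ clock (st r x) = 3 * q + 2, speaks r q &
    prefix (st r.+1 x) = rcons (prefix (st r x)) (utterance r q)].
Proof.
move=> sx; rewrite next_stateE sx.
case/andP: (sx) => w; rewrite w /=; case fr: (fresh r x) => /=.
  move=> _; exists x; case/and4P: (fr) => _ /eqP -> _ _.
  by rewrite /speaks w fr /utterance fr.
rewrite /heard_from_chair; case: eqP => //= clock2.
case: insubP => //= q _ qE; case mE: (mail r q x) => [v|] //= _.
have [sq qNx ->] := mail_sent mE.
exists q; split; rewrite ?sq //; first by move: clock2 qE; lia.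
rewrite encodeK //; apply: b_gt0.
by move: qNx; rewrite -val_eqE /=; have := ltn_ord q; have := ltn_ord x; lia.
Qed.

Lemma chair_stays r x q : working r x -> clock (st r x) = 3 * q + 2 ->
  speaks r q -> alive r.+1 q -> stays r x.
Proof.
move=> w cx sq aq; rewrite /stays w /=; have [/val_inj qx|qNx] := q =P x :> nat.
  by subst q; move: sq; rewrite /speaks cx => /andP[_ /orP[->//|]]; lia.
apply/orP; right; rewrite /heard_from_chair cx.
rewrite (_ : _ %% 3 == 2 = true); last by lia.
rewrite (_ : (3 * q + 2) %/ 3 = q); last by lia.
by rewrite valK /= sent_mail // eq_sym; apply/eqP => e; apply: qNx; rewrite e.
Qed.

(** The invariant of the induction on rounds. [clock_skew] persists thanks to [skewed_chair_dead],
    which itself rests on [reads_eq0]; [chair_done] and [sum_reads_le] yield completeness of the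
    prefix at the end. *)
Record synchronized r : Prop := Synchronized {
  clock_le : forall x, clock (st r x) <= 3 * k;
  prefixE : forall x, prefix (st r x) = take (size (prefix (st r x))) X;
  reads_le : forall x, reads (st r x) <= quota;
  size_add_clock : forall x, working r x ->
    size (prefix (st r x)) + clock (st r x) = r;
  clock_skew : forall x y, alive r x -> alive r y ->
    clock (st r x) <= (clock (st r y)).+1;
  skewed_chair_dead : forall x y q, alive r x -> alive r y ->
    clock (st r x) = 3 * q + 2 -> clock (st r y) = 3 * q + 3 -> ~~ alive r q;
  reads_eq0 : forall x q, alive r x -> alive r q ->
    clock (st r x) <= 3 * q + 1 -> reads (st r q) = 0;
  chair_done : forall x q, alive r x -> q \notin faulty A ->
    3 * q + 3 <= clock (st r x) ->
    reads (st r q) = quota \/ size (prefix (st r x)) = n;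
  sum_reads_le : forall x, alive r x ->
    \sum_(q | q \notin faulty A) reads (st r q) <= size (prefix (st r x))
}.

Lemma synchronized0 : synchronized 0.
Proof.
split=> //= [x|x y q _ _|x q _ _|x _]; [by rewrite take0 | lia | lia |].
by rewrite big1.
Qed.

(** * Preservation of the invariant by one round *)

Section Step.

Variables (r : nat) (S : synchronized r).
Hypothesis quota_gt0 : 0 < quota.

Lemma size_prefix_le x : size (prefix (st r x)) <= n.
Proof.
by rewrite (prefixE S) size_take size_tuple; case: ltnP => // /ltnW.
Qed.

(** By [size_add_clock], a chair at the clock of [x] reads precisely the bit [x] misses, and a chair
    one tick behind knows one bit more, so its last bit is the missing one. *)
Lemma prefixE_step x :
  prefix (st r.+1 x) = take (size (prefix (st r.+1 x))) X.
Proof.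
case sx: (stays r x); last first.
  by rewrite next_stateE sx; case: ifP => /= _; rewrite -(prefixE S).
have wx : working r x by case/andP: sx.
have [q [cx sq ->]] := stays_chair sx.
have wq : working r q by case/andP: sq.
case/andP: (wx) => x_lt ax; case/andP: (wq) => q_lt aq.
have tx := size_add_clock S wx; have tq := size_add_clock S wq.
have mq := size_prefix_le q.
rewrite size_rcons {1}(prefixE S) (take_nth false).
  congr rcons; rewrite /utterance; case fr: (fresh r q).
    by case/and4P: fr => _ /eqP cq _ _; congr nth; lia.
  move: sq; rewrite /speaks wq fr /= => /andP[/eqP cq mq0].
  rewrite (prefixE S) -nth_last nth_take; last first.
    by rewrite size_take size_tuple; case: ifP; lia.
  congr nth; rewrite size_take size_tuple.
  by have [|] := ltnP (size (prefix (st r q))) n; lia.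
rewrite size_tuple.
case/andP: sq => _ /orP[/and4P[_ /eqP cq _ ?]|/andP[/eqP cq _]]; lia.
Qed.

(** The gap could widen only if [y] stays while [x], one tick ahead, advances. But [y] stays because
    of a living chair, so [skewed_chair_dead] forbids [x] to be ahead. *)
Lemma clock_skew_step x y : alive r.+1 x -> alive r.+1 y ->
  clock (st r.+1 x) <= (clock (st r.+1 y)).+1.
Proof.
move=> /aliveW ax /aliveW ay; have sk := clock_skew S ax ay; rewrite !clockS.
have cy := clock_le S y; have cx := clock_le S x.
have wxE : working r x = (clock (st r x) < 3 * k) by rewrite /working ax andbT.
have wyE : working r y = (clock (st r y) < 3 * k) by rewrite /working ay andbT.
case sy: (stays r y); last by rewrite wxE wyE; lia.
have [q [cyq sq _]] := stays_chair sy.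
have aq : alive r q by case/andP: sq => /andP[].
have := skewed_chair_dead S ay ax cyq; rewrite aq wxE.
case: (clock (st r x) =P 3 * q + 3) => [e /(_ e)//|ne _]; lia.
Qed.

Lemma not_speaks_working r' q : working r' q -> ~~ speaks r' q ->
  (clock (st r' q) = 3 * q + 2 ->
    quota <= reads (st r' q) \/ n <= size (prefix (st r' q))) /\
  (clock (st r' q) = 3 * q + 1 -> size (prefix (st r' q)) = 0).
Proof.
by rewrite /speaks /fresh => -> /=; lia.
Qed.

(* A living chair that lets a peer's clock leave 3q+2 must have agreed with it
   on the clock: one step behind it would have repeated its last bit, and one
   step ahead is excluded by [skewed_chair_dead]. *)
Lemma silent_chair x q : alive r x -> alive r.+1 q ->
  clock (st r x) = 3 * q + 2 -> clock (st r.+1 x) = 3 * q + 3 ->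
  [/\ clock (st r q) = 3 * q + 2, size (prefix (st r q)) = size (prefix (st r x))
    & reads (st r q) = quota \/ size (prefix (st r x)) = n].
Proof.
move=> ax aq' cx cx'; have aq := aliveW aq'.
have wx : working r x by rewrite /working ax cx; have := ltn_ord q; lia.
have nsx : ~~ stays r x by move: cx'; rewrite clockS wx; lia.
have nsq : ~~ speaks r q.
  by apply: contra nsx => sq; apply: chair_stays wx cx sq aq'.
have := clock_skew S ax aq; have := clock_skew S aq ax => s1 s2.
have /negP nq3 : clock (st r q) != 3 * q + 3.
  by apply/eqP => /(skewed_chair_dead S ax aq cx); rewrite aq.
have wq : working r q by rewrite /working aq; have := ltn_ord q; lia.
have [h2 h1] := not_speaks_working wq nsq.
have tx := size_add_clock S wx; have tq := size_add_clock S wq.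
have cq : clock (st r q) = 3 * q + 2 by lia.
split=> //; first by lia.
have := reads_le S q; have := size_prefix_le x; lia.
Qed.

Lemma skewed_chair_dead_step x y q : alive r.+1 x -> alive r.+1 y ->
  clock (st r.+1 x) = 3 * q + 2 -> clock (st r.+1 y) = 3 * q + 3 ->
  ~~ alive r.+1 q.
Proof.
move=> ax' ay' cx' cy'; apply/negP => aq'.
have ax := aliveW ax'; have ay := aliveW ay'; have aq := aliveW aq'.
(* If [y] was at 3q+3 already, then [x] was at 3q+2, and the invariant makes [q] dead. *)
have cy : clock (st r y) = 3 * q + 2.
  move: (cy'); rewrite clockS; case: (boolP (_ && _)) => [_|_]; first by lia.
  rewrite addn0 => cy; have : clock (st r x) = 3 * q + 2.
    have := clock_skew S ay ax; move: cx'; rewrite clockS; lia.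
  by move/(skewed_chair_dead S ax ay)/(_ cy); rewrite aq.
have [cq sq dq] := silent_chair ay aq' cy cy'.
have wx : working r x.
  by rewrite /working ax; move: cx'; rewrite clockS; have := ltn_ord q; lia.
have wq : working r q by rewrite /working aq cq; have := ltn_ord q; lia.
have tx := size_add_clock S wx; have tq := size_add_clock S wq.
move: cx'; rewrite clockS wx /=; case sx: (stays r x) => /= cx'.
  have [q' [cq' sq' _]] := stays_chair sx.
  have qq : q' = q by apply: val_inj => /=; lia.
  move: sq'; rewrite qq /speaks /fresh; lia.
(* Here [q] has read nothing yet, so its silence means that it knows all of X; [x], one tick behind,
   would know n+1 bits. *)
have cx : clock (st r x) = 3 * q + 1 by lia.
have /(reads_eq0 S ax aq) : clock (st r x) <= 3 * q + 1 by rewrite cx.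
have := size_prefix_le x; lia.
Qed.

(** If [q] reads now, the skew bound puts [x] at 3q+1 or later; a clock at 3q+1 never stands still,
    so [x] reaches 3q+2. *)
Lemma reads_eq0_step x q : alive r.+1 x -> alive r.+1 q ->
  clock (st r.+1 x) <= 3 * q + 1 -> reads (st r.+1 q) = 0.
Proof.
move=> ax' aq'; have ax := aliveW ax'; have aq := aliveW aq'.
rewrite clockS readsS => cx.
rewrite (reads_eq0 S ax aq); last by lia.
apply/eqP; rewrite eqb0; apply/negP => /and4P[wq /eqP cq _ _].
have := clock_skew S aq ax => sk.
have wx : working r x by rewrite /working ax; case/andP: wq; lia.
have : ~~ stays r x.
  by apply/negP => /stays_chair[q' [cx' _ _]]; lia.
by rewrite wx in cx; lia.
Qed.

Lemma chair_done_step x q : alive r.+1 x -> q \notin faulty A ->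
  3 * q + 3 <= clock (st r.+1 x) ->
  reads (st r.+1 q) = quota \/ size (prefix (st r.+1 x)) = n.
Proof.
move=> ax' nq; have ax := aliveW ax'; have aq' := nonfaulty_alive r.+1 nq.
have dq : reads (st r.+1 q) <= quota.
  by rewrite readsS; have := reads_le S q; rewrite /fresh; lia.
have mx : size (prefix (st r.+1 x)) <= n.
  by rewrite prefixE_step size_take size_tuple; case: ltnP => // /ltnW.
move: dq mx; rewrite readsS size_prefixS.
have [/(chair_done S ax nq)|] := leqP (3 * q + 3) (clock (st r x)); first by lia.
move=> lt dq mx le.
have cx : clock (st r x) = 3 * q + 2 by move: le; rewrite clockS; lia.
have cx' : clock (st r.+1 x) = 3 * q + 3 by move: le; rewrite clockS; lia.
by have [_ _] := silent_chair ax aq' cx cx'; lia.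
Qed.

(** Reading happens at clocks 3 apart for successive chairs, beyond the skew of 1. *)
Lemma fresh_inj q q' : fresh r q -> fresh r q' -> q = q'.
Proof.
move=> /and4P[/andP[_ aq] /eqP cq _ _] /and4P[/andP[_ aq'] /eqP cq' _ _].
apply: val_inj => /=.
have := clock_skew S aq aq'; have := clock_skew S aq' aq; lia.
Qed.

Lemma sum_reads_le_step x : alive r.+1 x ->
  \sum_(q | q \notin faulty A) reads (st r.+1 q) <= size (prefix (st r.+1 x)).
Proof.
move=> ax'; have ax := aliveW ax'; have le_x := sum_reads_le S ax.
under eq_bigr do rewrite readsS.
rewrite big_split /=.
case: (pickP [pred q | (q \notin faulty A) && fresh r q]) => [q|none]; last first.
  rewrite [X in _ + X]big1 ?addn0 => [|q nq]; last first.
    by have := none q; rewrite /= nq /= => ->.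
  by rewrite size_prefixS (leq_trans le_x) // leq_addr.
move=> /= /andP[nq fq]; rewrite [X in _ + X](bigD1 q nq) /= fq.
rewrite [X in 1 + X]big1 ?addn0 => [|q' /andP[_ qq']]; last first.
  by apply/eqP; rewrite eqb0; apply: contra qq' => /(fresh_inj fq) ->.
have aq := nonfaulty_alive r nq; have aq' := nonfaulty_alive r.+1 nq.
have le_q := sum_reads_le S aq.
have wq : working r q by case/and4P: fq.
have cq : clock (st r q) = 3 * q + 2 by case/and4P: fq => _ /eqP.
have cx3 : clock (st r x) <> 3 * q + 3.
  by move/(skewed_chair_dead S aq ax cq); rewrite aq.
have := clock_skew S ax aq; have := clock_skew S aq ax => s1 s2.
have wx : working r x by rewrite /working ax; have := ltn_ord q; lia.
have tx := size_add_clock S wx; have tq := size_add_clock S wq.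
have sq : speaks r q by rewrite /speaks wq fq.
(* At the clock of [q], [x] gains the bit just read. Otherwise [x] is one tick behind, so its prefix
   already exceeds that of [q], which bounds the old sum. *)
rewrite size_prefixS; have [cx|cx] := clock (st r x) =P 3 * q + 2.
  by rewrite (chair_stays wx cx sq aq') leq_add.
rewrite (leq_trans _ (leq_addr _ _)) // addn1 (leq_ltn_trans le_q) //; lia.
Qed.

Lemma synchronized_step : synchronized r.+1.
Proof.
split.
- by move=> x; rewrite clockS; have := clock_le S x; rewrite /working; lia.
- exact: prefixE_step.
- by move=> x; rewrite readsS; have := reads_le S x; rewrite /fresh; lia.
- move=> x /andP[lt /aliveW ax]; move: lt; rewrite clockS => lt.
  have wx : working r x by rewrite /working ax; lia.
  by have := size_add_clock S wx; rewrite size_prefixS wx; lia.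
- exact: clock_skew_step.
- exact: skewed_chair_dead_step.
- exact: reads_eq0_step.
- exact: chair_done_step.
- exact: sum_reads_le_step.
Qed.

End Step.

Lemma synchronizedP r : 0 < quota -> synchronized r.
Proof.
move=> q_gt0; elim: r => [|r S]; first exact: synchronized0.
exact: synchronized_step.
Qed.

(** * Cost accounting and the final output *)

Lemma queries_madeE t x : queries_made P X A t x = reads (st t x).
Proof.
rewrite /queries_made; elim: t => [|t IH]; first by rewrite big_ord0.
by rewrite big_ord_recr IH card_asked readsS.
Qed.

(** A speaking round either increases [reads] or is the single round at clock 3x+1, which the
    Boolean counts once it is past. *)
Lemma messages_sent_le t x : messages_sent P X A t x <=
  k * (reads (st t x) + (3 * x + 2 <= clock (st t x))).
Proof.
rewrite /messages_sent; elim: t => [|t IH]; first by rewrite big_ord0.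
rewrite big_ord_recr /=; case sx: (speaks t x); last first.
  rewrite [X in _ + X](_ : _ = 0) ?addn0; last first.
    by apply/eqP; rewrite cards_eq0; apply/eqP/setP=> y; rewrite !inE sentE sx.
  apply: leq_trans IH _; rewrite leq_mul2l readsS clockS; lia.
have : #|[set y | isSome (sent X A t (state_after P X A t) x y)]| <= k.
  by rewrite -[leqRHS]card_ord max_card.
move/(leq_add IH)/leq_trans; apply; rewrite addnC -mulnS leq_mul2l.
rewrite readsS clockS; apply/orP; right.
have wx : working t x by case/andP: sx.
case/andP: sx => _ /orP[fx|/andP[/eqP cx _]]; first by rewrite fx; lia.
have nsx : ~~ stays t x.
  by apply/negP => /stays_chair[q [cx' _ _]]; lia.
by rewrite wx nsx; lia.
Qed.

Lemma clock_final t x : 0 < quota -> n + 3 * k <= t -> alive t x ->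
  clock (st t x) = 3 * k.
Proof.
move=> q_gt0 le_t ax; have S := synchronizedP t q_gt0.
have := clock_le S x; rewrite leq_eqVlt => /orP[/eqP //|lt].
have wx : working t x by rewrite /working lt ax.
by have := size_add_clock S wx; have := size_prefix_le S x; lia.
Qed.

(** If a bit were missing, every nonfaulty chair would have used its whole quota, and the reads
    would total at least [n], against [sum_reads_le]. *)
Lemma output_final t x : 0 < quota -> n <= quota * #|~: faulty A| ->
  n + 3 * k <= t -> alive t x -> output_after P X A t x = Some X.
Proof.
move=> q_gt0 enough le_t ax; have S := synchronizedP t q_gt0.
have cx := clock_final q_gt0 le_t ax.
have mx : size (prefix (st t x)) = n.
  apply/eqP; rewrite eqn_leq size_prefix_le //=; case: leqP => // lt.
  have := leq_ltn_trans (sum_reads_le S ax) lt.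
  rewrite (eq_bigr (fun=> quota)) => [|q nq]; last first.
    have le_q : 3 * q + 3 <= clock (st t x) by rewrite cx; have := ltn_ord q; lia.
    by have [//|mn] := chair_done S ax nq le_q; rewrite mn ltnn in lt.
  rewrite sum_nat_const (eq_card (B := ~: faulty A)); last first.
    by move=> q; rewrite unfold_in !inE.
  by rewrite mulnC ltnNge enough.
rewrite /output_after /= cx leqnn; congr Some; apply: eq_from_tnth => i.
by rewrite tnth_mktuple (prefixE S) mx take_oversize ?size_tuple // -tnth_nth.
Qed.

End Run.

(** * Bounds over all inputs and crash schedules *)

Section Complexity.

Hypothesis b_gt0 : 1 < k -> 0 < b.
Hypothesis quota_gt0 : 0 < quota.
Variable f : nat.

Lemma reads_total_le X A t :
  \sum_(q | q \notin faulty A)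
    reads (state_after chair_protocol X A t q : chair_state n) <= n.
Proof.
case: (pickP [pred q | q \notin faulty A]) => [q /= nq|none].
  have S := synchronizedP X A b_gt0 t quota_gt0.
  apply: leq_trans (sum_reads_le S (nonfaulty_alive t nq)) _.
  exact: size_prefix_le S q.
by rewrite big_pred0.
Qed.

Lemma chair_protocol_messages :
  message_complexity_le chair_protocol f (k * (n + k)).
Proof.
move=> X A _ t.
apply: (@leq_trans (\sum_(q | q \notin faulty A)
  k * (reads (state_after chair_protocol X A t q : chair_state n) + 1))).
  apply: leq_sum => q _; apply: leq_trans (messages_sent_le X A b_gt0 t q) _.
  by rewrite leq_mul2l leq_add2l leq_b1 orbT.
rewrite -big_distrr /= leq_mul2l big_split /= leq_add ?orbT ?reads_total_le //.
by rewrite sum1_card -[leqRHS]card_ord max_card.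
Qed.

Lemma chair_protocol_queries X A t q :
  queries_made chair_protocol X A t q <= quota.
Proof.
rewrite queries_madeE.
exact: reads_le (synchronizedP X A b_gt0 t quota_gt0) q.
Qed.

Lemma chair_protocol_time B : n + 3 * k <= B ->
  time_complexity_le chair_protocol f B.
Proof.
move=> le_B X A _ q nq; rewrite /output_after /=.
by rewrite (clock_final X b_gt0 quota_gt0 le_B (nonfaulty_alive B nq)) leqnn.
Qed.

Lemma chair_protocol_solves : n <= quota * (k - f) ->
  solves_download chair_protocol f.
Proof.
move=> enough X A le_f q nq; exists (n + 3 * k).
apply: output_final => //; last exact: nonfaulty_alive.
apply: leq_trans enough _; rewrite leq_mul2l; apply/orP; right.
by have := cardsC (faulty A); rewrite card_ord; lia.
Qed.

End Complexity.
End ChairProtocol.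

Local Open Scope ring_scope.

Theorem theorem5p16 (R : realType) :
  exists cS cQ cT cM : nat,
  forall (beta gamma : R) (n k f : nat),
    0 <= beta < 1 -> gamma = 1 - beta ->
    (0 < k)%N -> (k <= n)%N -> f%:R <= beta * k%:R ->
  exists P : protocol n k (cS * up_log 2 n),
    [/\ solves_download P f,
        query_complexity_le P f (cQ%:R * (n%:R / (gamma * k%:R))),
        time_complexity_le P f (cT * (n + f)) &
        message_complexity_le P f (cM * (k * (n + f)))].
Proof.
(* Since k - f <= k <= n, the quota is at most 2n/(k-f), with k - f >= (1-beta)k; also n + 3k <= 4n
   and n + k <= 2n. *)
exists 1, 2, 4, 2 => beta gamma n k f /andP[beta_ge0 beta_lt1] ->.
move=> k_gt0 le_kn le_f.
have kR : 0 < k%:R :> R by rewrite ltr0n.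
have lt_fk : (f < k)%N.
  by rewrite -(ltr_nat R) (le_lt_trans le_f) // gtr_pMl.
pose quota := (n %/ (k - f)).+1.
have b_gt0 : (1 < k -> 0 < 1 * up_log 2 n)%N.
  by move=> lt1k; rewrite mul1n up_log_gt0; lia.
have := divn_eq n (k - f); have := ltn_pmod n (_ : 0 < k - f)%N.
move=> /(_ ltac:(lia)) lt_mod divE.
exists (chair_protocol n k _ quota); split.
- by apply: chair_protocol_solves => //; rewrite /quota; nia.
- move=> X A _ q _ t.
  apply: (@le_trans _ _ quota%:R); first by rewrite ler_nat chair_protocol_queries.
  have gk : 0 < (1 - beta) * k%:R by rewrite mulr_gt0 // subr_gt0.
  rewrite mulrA ler_pdivlMr //.
  have : (1 - beta) * k%:R <= (k - f)%:R.
    by rewrite natrB ?(ltnW lt_fk) // mulrBl mul1r lerB.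
  move/(ler_wpM2l (ler0n R quota))/le_trans; apply.
  by rewrite -!natrM ler_nat /quota; nia.
- by apply: chair_protocol_time => //; lia.
- move=> X A le_fA t.
  apply: leq_trans (chair_protocol_messages b_gt0 (ltn0Sn _) X le_fA t) _.
  by rewrite mulnCA leq_mul2l; lia.
Qed.
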